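(* Let $F \subseteq E$ be a Galois extension and let $\mathfrak{h}$ be a finite-dimensional Lie algebra over the field $F$. Then there exist, up to isomorphism of Lie algebras over $E$, only finitely many (possibly no) Lie algebras $\mathfrak{g}$ over $E$ such that $\mathfrak{g}_F \cong \mathfrak{h}$ as Lie algebras over $F$.
   Context: A Galois extension $F \subseteq E$ means a field extension of finite degree with $|\mathrm{Aut}(E,F)| = [E:F]$, where $\mathrm{Aut}(E,F)$ is the group of field automorphisms of $E$ fixing $F$ pointwise. For a Lie algebra $\mathfrak{g}$ over $E$, the underlying Lie algebra $\mathfrak{g}_F$ is $\mathfrak{g}$ regarded as a Lie algebra over $F$ by restricting the scalar multiplication. *)

(* Defs.v *)
From HB Require Import structures.
From mathcomp Require Import all_boot all_order all_algebra all_field.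

Set Implicit Arguments.
Unset Strict Implicit.
Unset Printing Implicit Defensive.

Import GRing.Theory.
Local Open Scope ring_scope.

HB.mixin Record Lmodule_isLieAlgebra (K : fieldType) L of GRing.Lmodule K L := {
  lie_bracket : L -> L -> L;
  lie_bracket_linearl : forall y, linear (fun x => lie_bracket x y);
  lie_bracket_linearr : forall x, linear (lie_bracket x);
  lie_bracketxx : forall x, lie_bracket x x = 0;
  lie_jacobi : forall x y z,
    lie_bracket x (lie_bracket y z) + lie_bracket y (lie_bracket z x)
      + lie_bracket z (lie_bracket x y) = 0
}.

#[short(type="lieAlgType")]
HB.structure Definition LieAlgebra (K : fieldType) :=
  { L of GRing.Lmodule K L & Lmodule_isLieAlgebra K L }.

#[short(type="finDimLieAlgType")]
HB.structure Definition FinDimLieAlgebra (K : fieldType) :=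
  { L of LieAlgebra K L & Vector K L }.

Definition lie_isomorphic (K : fieldType) (g h : lieAlgType K) : Prop :=
  exists f : {linear g -> h},
    bijective f /\ {morph f : x y / lie_bracket x y >-> lie_bracket x y}.

(* The alias carries the scalar action of F through F -> E, a |-> a%:A. *)
Definition restrict_scalars (F : fieldType) (E : fieldExtType F)
  (V : Type) : Type := V.

Section RestrictScalarsLmodule.

Variables (F : fieldType) (E : fieldExtType F) (V : lmodType E).
Local Notation VF := (restrict_scalars E V).

HB.instance Definition _ := GRing.Zmodule.on VF.

Definition restr_scale (a : F) (v : VF) : VF := (a%:A : E) *: (v : V).

Fact restr_scaleA a b v : restr_scale a (restr_scale b v) = restr_scale (a * b) v.
Proof. by rewrite /restr_scale scalerA -scalerAl mul1r scalerA. Qed.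

Fact restr_scale1 : left_id 1 restr_scale.
Proof. by move=> v; rewrite /restr_scale !scale1r. Qed.

Fact restr_scaleDr : right_distributive restr_scale +%R.
Proof. by move=> a u v; apply: scalerDr. Qed.

Fact restr_scaleDl v : {morph restr_scale^~ v : a b / a + b}.
Proof. by move=> a b; rewrite /restr_scale !scalerDl. Qed.

HB.instance Definition _ := GRing.Zmodule_isLmodule.Build F VF
  restr_scaleA restr_scale1 restr_scaleDr restr_scaleDl.

Lemma restr_scaleE (a : F) (v : V) : a *: (v : VF) = (a%:A : E) *: v.
Proof. by []. Qed.

End RestrictScalarsLmodule.

Section RestrictScalarsLie.

Variables (F : fieldType) (E : fieldExtType F) (g : lieAlgType E).
Local Notation gF := (restrict_scalars E g).

Definition restr_bracket (x y : gF) : gF := lie_bracket (x : g) (y : g).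

Fact restr_bracket_linearl y : linear (fun x => restr_bracket x y).
Proof. by move=> a u v; apply: (lie_bracket_linearl (y : g)). Qed.

Fact restr_bracket_linearr x : linear (restr_bracket x).
Proof. by move=> a u v; apply: (lie_bracket_linearr (x : g)). Qed.

Fact restr_bracketxx x : restr_bracket x x = 0.
Proof. exact: (lie_bracketxx (x : g)). Qed.

Fact restr_jacobi x y z :
  restr_bracket x (restr_bracket y z) + restr_bracket y (restr_bracket z x)
    + restr_bracket z (restr_bracket x y) = 0.
Proof. exact: (lie_jacobi (x : g) (y : g) (z : g)). Qed.

HB.instance Definition _ := Lmodule_isLieAlgebra.Build F gF
  restr_bracket_linearl restr_bracket_linearr restr_bracketxx restr_jacobi.

End RestrictScalarsLie.

(* |Aut(E, F)| = [E : F], with Aut(E, F) = {f | kAut 1 {:E} f} enumerated by s.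
   The type 'Gal({:E} / 1) is not used: it presupposes that E / F is normal. *)
Definition galois_extension (F : fieldType) (E : fieldExtType F) : Prop :=
  exists s : seq 'End(E),
    [/\ uniq s, forall f, (f \in s) = kAut 1 {:E} f & size s = \dim {:E}].

(* Main.v *)
(* An [E]-structure on [h] is a ring homomorphism from [E] to the centroid of
   [h]. Elements of the centroid commute on the derived algebra [D], and those
   coming from [E] are annihilated there by separable polynomials that split
   over [E]; over [E] they are therefore simultaneously diagonalisable, which
   leaves finitely many possible actions of [E] on [D]. Two structures [g1],
   [g2] with the same action on [D] are isomorphic: the identity of [h] is
   [E]-linear on [D] and [E]-linear modulo the centre, so it can be changed by
   central values, away from [D], into an [E]-linear bijection [tau]. Such a
   change does not affect brackets, hence [tau] is a Lie isomorphism. *)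
From HB Require Import structures.
Require Import Defs.
From mathcomp Require Import all_boot all_order all_algebra all_field.
From Stdlib Require Import Classical_Prop.

Set Implicit Arguments.
Unset Strict Implicit.
Unset Printing Implicit Defensive.

Import GRing.Theory.
Local Open Scope ring_scope.

(** * Independence of automorphisms and their fixed field *)

(** Induction on [s]: subtracting [chi j y] times the relation at [x] from the relation at [y * x]
    eliminates [chi j] and leaves a shorter relation with coefficients
    [c i * (chi i y - chi j y)]. *)
Lemma dedekind_independence (R : pzRingType) (L : fieldType) (I : eqType)
    (s : seq I) (chi : I -> R -> L) :
    uniq s -> (forall i, i \in s -> chi i 1 = 1) ->
    (forall i, i \in s -> {morph chi i : x y / x * y}) ->
    {in s &, forall i j, chi i =1 chi j -> i = j} ->
  forall c : I -> L, (forall x, \sum_(i <- s) c i * chi i x = 0) ->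
  forall i, i \in s -> c i = 0.
Proof.
elim: s => [//|j s IHs] /= /andP[js us] chi1 chiM chi_inj c c0.
have s_sub i : i \in s -> i \in j :: s by rewrite inE orbC => ->.
have cs0 i : i \in s -> c i = 0.
  move=> i_s; apply/eqP/idPn => ci.
  suff eq_ij : i = j by rewrite -eq_ij i_s in js.
  apply: (chi_inj); rewrite ?inE ?eqxx ?i_s ?orbT // => y.
  apply/eqP; rewrite -subr_eq0 -(mulrI_eq0 _ (mulfI ci)); apply/eqP.
  apply: (IHs us _ _ _ (fun i => c i * (chi i y - chi j y))) => //.
  - by move=> k /s_sub; apply: chi1.
  - by move=> k /s_sub; apply: chiM.
  - by move=> k l /s_sub ks /s_sub ls; apply: chi_inj.
  move=> x; have /eqP := c0 (y * x); have /eqP := c0 x.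
  rewrite !big_cons ![c j * _ + _]addrC !addr_eq0 => /eqP cx /eqP cyx.
  transitivity (\sum_(k <- s) c k * chi k (y * x) - chi j y * \sum_(k <- s) c k * chi k x).
    rewrite mulr_sumr -sumrB; apply: eq_big_seq => k /s_sub ks.
    by rewrite chiM// mulrBr mulrBl mulrA [chi j y * _]mulrCA !mulrA.
  by rewrite cx cyx chiM ?mem_head// mulrN opprK mulrCA addNr.
move=> i; rewrite inE => /predU1P[->|/cs0//].
have := c0 1; rewrite big_cons chi1 ?mem_head// mulr1 big1_seq ?addr0//.
by move=> k /= /cs0->; rewrite mul0r.
Qed.

Section GaloisExtension.

Variables (F : fieldType) (E : fieldExtType F) (s : seq 'End(E)).
Hypotheses (us : uniq s) (sE : forall f, (f \in s) = kAut 1 {:E} f).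
Hypothesis size_s : size s = \dim {:E}.

Let s_mult f : f \in s -> monoid_morphism f.
Proof. by rewrite sE kAutfE => /kHom_monoid_morphism. Qed.

Lemma automorphism_inj f : f \in s -> injective f.
Proof.
move=> fs; have [f1 fM] := s_mult fs.
have f0 x : f x = 0 -> x = 0.
  move=> fx0; have [//|x0] := eqVneq x 0; have := f1.
  by rewrite -{1}(divff x0) fM fx0 mul0r => /esym/eqP; rewrite oner_eq0.
by move=> x y /eqP; rewrite -subr_eq0 -linearB => /eqP/f0/eqP; rewrite subr_eq0 => /eqP.
Qed.

(* By independence the coordinate functional [coord e i0] is a combination of
   automorphisms, hence linear over their fixed field. *)
Lemma fixed_by_automorphisms (k : E) :
  (forall f, f \in s -> f k = k) -> exists a : F, k = a%:A.
Proof.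
move=> fixk; pose n := \dim {:E}; pose e := vbasis {:E}.
have coordE x : x = \sum_(j < n) coord e j x *: e`_j.
  by rewrite {1}(coord_vbasis (memvf x)).
pose M := \matrix_(i < n, j < n) (s`_i e`_j : E).
have s_i (i : 'I_n) : s`_i \in s by rewrite mem_nth ?size_s.
pose l (c : 'rV[E]_n) x := \sum_(i < n) c 0 i * s`_i x.
have lE c x : l c x = \sum_(j < n) (coord e j x)%:A * (c *m M) 0 j.
  rewrite {1}(coordE x) /l.
  under eq_bigr => i _ do rewrite linear_sum mulr_sumr.
  rewrite exchange_big; apply: eq_bigr => j _; rewrite mxE mulr_sumr.
  by apply: eq_bigr => i _; rewrite linearZ mxE mulr_algl scalerAr.
(* A vector in the left kernel of [M] is a linear relation among the automorphisms. As [s] has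
   [\dim {:E}] elements, [M] is square, so freeness gives invertibility. *)
have Mfree : row_free M.
  rewrite -kermx_eq0; apply/rowV0P => c /sub_kermxP cM0.
  apply/rowP => i; rewrite mxE.
  apply: (@dedekind_independence _ _ _ (enum 'I_n) (fun i x => s`_i x) _ _ _ _ (c 0)) => //.
  - exact: enum_uniq.
  - by move=> j _; case: (s_mult (s_i j)).
  - by move=> j _; case: (s_mult (s_i j)).
  - move=> i1 i2 _ _ /lfunP/eqP; rewrite nth_uniq ?size_s// => /eqP; exact: val_inj.
  - move=> x; rewrite big_enum -/(l c x) lE big1 // => j _.
    by rewrite cM0 mxE mulr0.
  - by rewrite mem_enum.
have Munit : M \in unitmx by rewrite -row_free_unit.
have n_gt0 : (0 < n)%N by rewrite adim_gt0.
pose i0 := Ordinal n_gt0.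
(* Chosen so that [c *m M] is the unit row at [i0], which makes [l c] the coordinate functional
   there. *)
pose c := delta_mx 0 i0 *m invmx M : 'rV_n.
have lcE x : l c x = (coord e i0 x)%:A.
  rewrite lE mulmxKV // (bigD1 i0) //= !mxE !eqxx mulr1 big1 ?addr0// => j.
  by rewrite mxE eqxx /= => /negPf->; rewrite mulr0.
have lk x : l c (k * x) = k * l c x.
  rewrite /l mulr_sumr; apply: eq_bigr => i _.
  by rewrite (s_mult (s_i i)).2 fixk// mulrCA.
exists (coord e i0 (k * e`_i0)).
rewrite -lcE lk lcE coord_free ?eqxx ?scale1r ?mulr1//.
exact: basis_free (vbasisP _).
Qed.

End GaloisExtension.

(** * Finiteness of commuting families of matrices *)

(** The roots [rs] are all conjugates of elements of [b]. Automorphisms permute them, so the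
    coefficients of the product are fixed and hence lie in [F]; [undup] makes the roots simple. *)
Lemma split_polynomial_over_base (F : fieldType) (E : fieldExtType F)
    (galEF : galois_extension E) (b : seq E) :
  exists (q : {poly F}) (rs : seq E), [/\ uniq rs, {subset b <= rs}
    & map_poly (in_alg E) q = \prod_(r <- rs) ('X - r%:P)].
Proof.
have [s [us sE size_s]] := galEF.
pose rs := undup [seq (f : 'End(E)) x | f <- s, x <- b].
have rs_uniq : uniq rs by exact: undup_uniq.
have rs_stable f : f \in s -> perm_eq (map f rs) rs.
  move=> fs; have f_inj := automorphism_inj sE fs.
  apply: uniq_perm => //; first by rewrite map_inj_uniq.
  (* The image of [rs] under the injective [f] lies in [rs] and has the same size, so the two
     coincide. *)
  apply: (uniq_min_size _ _ _).2; rewrite ?map_inj_uniq ?size_map// => y /mapP[x].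
  rewrite !mem_undup => /allpairsP[[g z] /= [gs zb ->]] ->.
  apply/allpairsP; exists ((f \o g)%VF, z); split; rewrite //= ?comp_lfunE//.
  by move: fs gs; rewrite !sE !kAutfE; exact: comp_kHom.
suff /polyOver1P[q qE] : \prod_(r <- rs) ('X - r%:P) \is a polyOver 1%VS.
  exists q, rs; split=> // x xb; rewrite mem_undup.
  apply/allpairsP; exists (\1%VF, x); split; rewrite //= ?id_lfunE// sE kAutfE.
  exact: kHom1.
apply/polyOverP => i; apply/vlineP; apply: (fixed_by_automorphisms us sE size_s).
move=> f fs; have /kHom_monoid_morphism f_morph : kHom 1 {:E} f by rewrite -kAutfE -sE.
pose fR : {rmorphism E -> E} := HB.pack (fun_of_lfun f)
  (GRing.isMonoidMorphism.Build E E (fun_of_lfun f) f_morph).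
rewrite -[fun_of_lfun f]/(fR : E -> E) -coef_map (map_prod_XsubC fR).
by rewrite -[in RHS](perm_big _ (rs_stable f fs)) big_map.
Qed.

(** Classically, if no list exhausted [P], fresh elements could be added one by one until [N.+1] of
    them were listed. *)
Lemma finite_of_bounded_size (T : eqType) (P : T -> Prop) (N : nat) :
    (forall s, uniq s -> (forall x, x \in s -> P x) -> size s <= N)%N ->
  exists s : seq T, forall x, P x -> x \in s.
Proof.
move=> bound; apply: NNPP => no_enum.
suff [s [us sP size_s]] : exists s, [/\ uniq s, forall x, x \in s -> P x & size s = N.+1].
  by have := bound s us sP; rewrite size_s ltnn.
elim: N.+1 => [|k [s [us sP <-]]]; first by exists [::].
have [x [Px xs]] : exists x, P x /\ x \notin s.
  apply: NNPP => no_x; apply: no_enum; exists s => x Px.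
  by apply/negPn/negP => xs; apply: no_x; exists x.
exists (x :: s); split; rewrite //= ?xs// => y; rewrite inE => /predU1P[->//|].
exact: sP.
Qed.

(** Over [L] each matrix is killed by a product of distinct linear factors, hence diagonalisable,
    and commuting ones are so simultaneously. In a common eigenbasis a matrix is a choice of roots
    along the diagonal, which bounds how many there are. *)
Lemma finite_commuting_roots (F L : fieldType) (f : {rmorphism F -> L})
    (q : {poly F}) (rs : seq L) (n : nat) (P : 'M[F]_n.+1 -> Prop) :
    uniq rs -> map_poly f q = \prod_(r <- rs) ('X - r%:P) ->
    (forall A B, P A -> P B -> A *m B = B *m A) ->
    (forall A, P A -> horner_mx A q = 0) ->
  exists s : seq 'M[F]_n.+1, forall A, P A -> A \in s.
Proof.
move=> rs_uniq qE Pcomm Pq.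
apply: (@finite_of_bounded_size _ _ #|{ffun 'I_n.+1 -> 'I_(size rs).+1}|) => s us sP.
have minpoly_dvd A : P A -> mxminpoly (map_mx f A) %| \prod_(r <- rs) ('X - r%:P).
  by move=> PA; rewrite -qE; apply: mxminpoly_min; rewrite -map_horner_mx Pq ?map_mx0.
(* The eigenbasis [U] depends on the list [s]; only the bound on [size s] has to be uniform. *)
have [|U Uunit /allP diagU] := (mxpoly.codiagonalizableP (map (map_mx f) s)).1.
  split=> [_ _ /mapP[A As ->] /mapP[B Bs ->]|_ /mapP[A As ->]].
    by rewrite /comm_mx -!map_mxM Pcomm//; exact: sP.
  by apply/mxpoly.diagonalizableP; exists rs => //; exact/minpoly_dvd/sP.
pose eig (A : 'M_n.+1) i := conjmx U (map_mx f A) i i.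
have eig_rs A i : A \in s -> eig A i \in rs.
  move=> As; have := minpoly_dvd A (sP A As).
  rewrite (diagonalizable_for_mxminpoly Uunit (diagU _ (map_f _ As))) => /dvdpP[p pE].
  rewrite -root_prod_XsubC pE rootM; apply/orP; right.
  by rewrite root_prod_XsubC mem_undup map_f ?mem_enum.
(* The successor on [size rs] only serves [inord], which needs an inhabited ordinal type. *)
pose code A := [ffun i => inord (index (eig A i) rs)] : {ffun 'I_n.+1 -> 'I_(size rs).+1}.
have code_inj : {in s &, injective code}.
  move=> A B As Bs /ffunP eqAB; apply: (map_mx_inj (f := f)).
  have /diagonalizable_forPex[a /(simmxLR Uunit) aE] := diagU _ (map_f _ As).
  have /diagonalizable_forPex[b /(simmxLR Uunit) bE] := diagU _ (map_f _ Bs).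
  suff eq_ab : a = b by rewrite aE bE eq_ab.
  apply/rowP => i; have /(congr1 val) := eqAB i; rewrite !ffunE /=.
  rewrite !inordK ?ltnS ?index_size// => /(congr1 (nth 0 rs)).
  rewrite !nth_index ?eig_rs// /eig aE bE !conjmxVK//.
  by rewrite !mxE eqxx.
rewrite -(size_map code) -(card_uniqP _) ?map_inj_in_uniq//.
exact: max_card.
Qed.

(* [R] is not assumed unital: it will be a representation on a direct summand,
   extended by zero, which is why [0] is added to the roots. *)
Lemma finite_commuting_representations (F : fieldType) (E : fieldExtType F)
    (galEF : galois_extension E) (n : nat) (P : {linear E -> 'M[F]_n} -> Prop)
    (b : seq E) :
    (forall R, P R -> {morph R : x y / x * y >-> x *m y}) ->
    (forall R R' x y, P R -> P R' -> R x *m R' y = R' y *m R x) ->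
  exists s : seq 'M[F]_n, forall R x, P R -> x \in b -> R x \in s.
Proof.
case: n P => [|n] P PM Pcomm.
  by exists [:: 0] => R x _ _; rewrite inE; apply/eqP; exact: flatmx0.
have [q [rs [rs_uniq b_rs qE]]] := split_polynomial_over_base galEF (0 :: b).
have [||s sP] := @finite_commuting_roots _ _ (in_alg E) q rs n
  (fun A => exists R x, [/\ P R, x \in b & A = R x]) rs_uniq qE.
- by move=> _ _ [R [x [PR xb ->]]] [R' [y [PR' yb ->]]]; apply: Pcomm.
- move=> _ [R [x [PR xb ->]]].
  have q_root y : y \in 0 :: b -> (map_poly (in_alg E) q).[y] = 0.
    by move/b_rs; rewrite qE -root_prod_XsubC => /rootP.
  have RM y z : R (y * z) = R y * R z by rewrite PM.
  (* The extra factor [R x] makes polynomial evaluation compatible with [R] even when [R 1] is not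
     the identity. *)
  have hornerR p : horner_mx (R x) p * R x = R ((map_poly (in_alg E) p).[x] * x).
    elim/poly_ind: p => [|p c IHp]; first by rewrite !rmorph0 horner0 !mul0r linear0.
    rewrite !(rmorphD, rmorphM) /= map_polyX map_polyC horner_mx_X horner_mx_C.
    rewrite mulrDl IHp -RM hornerMXaddC mulrDl linearD /= mulr_algl linearZ /=.
    by rewrite -mul_scalar_mx.
  (* Since [0] is a root, [q] has the form [p * 'X], which supplies the extra factor in
     [hornerR]. *)
  have q0 : root q 0.
    by rewrite -(fmorph_root (in_alg E)) rmorph0 /root q_root ?mem_head.
  have /factor_theorem[p qp] := q0; move: qp; rewrite subr0 => qp.
  rewrite qp rmorphM /= horner_mx_X hornerR -[X in R X](_ : 0 = _) ?linear0//.
  have := q_root x; rewrite inE xb orbT qp rmorphM /= map_polyX hornerM hornerX.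
  by move=> ->.
by exists s => R x PR xb; apply: sP; exists R, x.
Qed.

(** * Correcting an additive bijection to a linear one *)

Lemma span_ind (K : fieldType) (V : vectType K) (X : seq V) (P : V -> Prop) :
    P 0 -> (forall a x y, x \in X -> P y -> P (a *: x + y)) ->
  forall x, x \in <<X>>%VS -> P x.
Proof.
move=> P0 PX x /(coord_span (X := in_tuple X)) ->.
by elim/big_rec: _ => // i y _ Py; apply: PX => //=; exact: mem_nth.
Qed.

(* A linear map that agrees with [theta] on [D] and on a basis of a complement
   of [D] need not be bijective; it is corrected by sending its kernel onto a
   complement of its image with vectors [theta x - tau0 x]. *)
Lemma linear_correction (K : fieldType) (V1 V2 : vectType K) (theta : V1 -> V2)
    (D : {vspace V1}) (Z : V2 -> Prop) :
    \dim {:V1} = \dim {:V2} -> bijective theta ->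
    {morph theta : x y / x + y} ->
    {in D, forall x a, theta (a *: x) = a *: theta x} ->
    Z 0 -> (forall a x y, Z x -> Z y -> Z (a *: x + y)) ->
    (forall a x, Z (theta (a *: x) - a *: theta x)) ->
  exists tau : {linear V1 -> V2},
    [/\ bijective tau, {in D, tau =1 theta} & forall x, Z (tau x - theta x)].
Proof.
move=> eq_dim [theta' thetaK theta'K] thetaD thetaZ Z0 Zlin thetaN.
have theta0 : theta 0 = 0 by apply: (addrI (theta 0)); rewrite -thetaD !addr0.
have ZN x : Z x -> Z (- x) by move=> Zx; rewrite -[- x]addr0 -scaleN1r; apply: Zlin.
have ZD x y : Z x -> Z y -> Z (x + y) by rewrite -{2}[x]scale1r; apply: Zlin.
pose b := vbasis D ++ vbasis D^C.
have b_free : free b.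
  rewrite cat_free !(basis_free (vbasisP _)) !(span_basis (vbasisP _)).
  exact/directv_addP/capv_compl.
have b_span x : x \in <<b>>%VS.
  by rewrite span_cat !(span_basis (vbasisP _)) addv_complf memvf.
have [tau0L tau0b] := linear_of_free b (map theta b).
have {}tau0b : {in b, tau0L =1 theta}.
  by apply/eq_in_map/tau0b; rewrite ?size_map.
pose tau0 := linfun tau0L.
have tau0E x : tau0 x = tau0L x by rewrite lfunE.
have tau0Z x : Z (tau0 x - theta x).
  move: x (b_span x); apply: span_ind => [|a x y xb Zy].
    by rewrite linear0 theta0 subrr.
  rewrite linearP /= thetaD [tau0 x]tau0E tau0b// opprD addrACA.
  by apply: ZD => //; rewrite -opprB; apply: ZN.
have tau0D : {in D, tau0 =1 theta}.
  move=> x; rewrite -{1}(span_basis (vbasisP D)) => xD.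
  suff [] : x \in D /\ tau0 x = theta x by [].
  move: x xD; apply: span_ind => [|a x y xb [yD tau0y]].
    by rewrite mem0v linear0 theta0.
  have xD := vbasis_mem xb; split; first by rewrite rpredD ?rpredZ.
  by rewrite linearP /= thetaD tau0y thetaZ// [tau0 x]tau0E tau0b// mem_cat xb.
pose N := lker tau0; pose C := (limg tau0)^C%VS; pose W := (N + D)^C%VS.
(* On [D] the map [tau0] agrees with the injective [theta], so a correction supported on [N] can
   vanish on [D]. *)
have ND0 : (N :&: D = 0)%VS.
  apply/eqP; rewrite -subv0; apply/subvP=> x /memv_capP[]; rewrite memv_ker => /eqP x0 xD.
  by rewrite memv0; apply/eqP/(can_inj thetaK); rewrite theta0 -tau0D.
have dimNC : \dim C = \dim N.
  by rewrite dimv_compl -eq_dim -(limg_ker_dim tau0 fullv) capfv addnK.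
pose b' := vbasis N ++ (vbasis D ++ vbasis W).
have b'_free : free b'.
  rewrite /b' catA !cat_free !(basis_free (vbasisP _)) !span_cat !(span_basis (vbasisP _)).
  by rewrite (introT directv_addP ND0) (introT directv_addP (capv_compl _)).
(* For [x = theta' c] this vector is [c - tau0 x], that is, [c] modulo the image of [tau0]. *)
pose z := [seq theta x - tau0 x | x <- map theta' (vbasis C)].
have size_z : size z = size (vbasis N) by rewrite !size_map !size_tuple dimNC.
have [nu nub] := linear_of_free b' (z ++ nseq (\dim D + \dim W) 0).
have [nuN nu0] : map nu (vbasis N) = z /\ {in vbasis D ++ vbasis W, forall x, nu x = 0}.
  have : map nu b' = z ++ nseq (\dim D + \dim W) 0.
    by apply: nub => //; rewrite !size_cat size_z size_nseq !size_tuple.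
  rewrite map_cat => /eqP; rewrite eqseq_cat ?size_z ?[size (map nu _)]size_map// => /andP[/eqP-> /eqP nu0].
  by split=> // x xb; have := map_f nu xb; rewrite nu0 => /nseqP[].
have nuZ x : Z (nu x).
  have: x \in <<b'>>%VS.
    by rewrite /b' catA !span_cat !(span_basis (vbasisP _)) addv_complf memvf.
  move: x; apply: span_ind => [|a x y xb Zy]; first by rewrite linear0.
  rewrite linearP /=; apply: Zlin => //.
  move: xb; rewrite mem_cat => /orP[xN|/nu0->//].
  have := map_f nu xN; rewrite nuN => /mapP[u _ ->].
  by rewrite -opprB; apply/ZN/tau0Z.
pose tau := (tau0 + linfun nu)%VF.
have tauE x : tau x = tau0 x + nu x by rewrite add_lfunE [linfun nu x]lfunE.
have tau_basis x : x \in vbasis D ++ vbasis W -> tau x = tau0 x.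
  by move=> xb; rewrite tauE nu0// addr0.
(* [tau0] kills [N], so its image already comes from [D + W], where [tau] and [tau0] agree. *)
have tau0_lim : (limg tau0 <= limg tau)%VS.
  have -> : limg tau0 = (tau0 @: <<vbasis D ++ vbasis W>>)%VS.
    rewrite span_cat !(span_basis (vbasisP _)) -(addv_complf (N + D)) -addvA.
    rewrite limgD; apply/eqP; rewrite eqEsubv addvSr subv_add subvv andbT.
    rewrite (_ : (tau0 @: N)%VS = 0%VS) ?sub0v//; apply/eqP; rewrite -subv0.
    apply/subvP=> _ /memv_imgP[x xN ->]; move: xN; rewrite memv_ker => /eqP x0.
    by rewrite x0 mem0v.
  rewrite limg_span; apply/span_subvP => _ /mapP[x xb ->].
  by rewrite -tau_basis ?memv_img ?memvf.
have tau_surj : limg tau = fullv.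
  apply/eqP; rewrite eqEsubv subvf -(addv_complf (limg tau0)) subv_add tau0_lim.
  rewrite -/C -(span_basis (vbasisP C)); apply/span_subvP => c cC.
  have : theta (theta' c) - tau0 (theta' c) \in map nu (vbasis N).
    by rewrite nuN; apply: map_f; apply: map_f.
  case/mapP => x xN; rewrite theta'K => /eqP; rewrite subr_eq => /eqP->.
  apply: rpredD; last by apply: (subvP tau0_lim); rewrite memv_img ?memvf.
  have <- : tau x = nu x by rewrite tauE (eqP (_ : tau0 x == 0)) ?add0r// -memv_ker vbasis_mem.
  by rewrite memv_img ?memvf.
have tau_inj : lker tau == 0%VS.
  by rewrite -dimv_eq0 -(eqn_add2r (\dim (limg tau))) -{1}[lker tau]capfv limg_ker_dim tau_surj eq_dim.
exists tau; split=> [|x xD|x]; last by rewrite /= tauE addrAC; exact: ZD.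
  exists (tau^-1)%VF; first exact: lker0_lfunK.
  by move=> y; apply: limg_lfunVK; rewrite tau_surj memvf.
rewrite -tau0D //= tauE [nu x](_ : _ = 0) ?addr0//.
move: xD; rewrite -{1}(span_basis (vbasisP D)); move: x; apply: span_ind => [|a x y xb nuy].
  by rewrite linear0.
by rewrite linearP /= nuy nu0 ?scaler0 ?addr0// mem_cat xb.
Qed.

(** * Finite dimension over the larger field *)

(** An injective [E]-linear map from ['rV[E]_n] forces [n * \dim {:E} <= \dim {:H}], so adjoining
    vectors outside the image must stop, and it stops at a basis. The formula makes the
    [E]-dimension depend on [H] alone. *)
Lemma exists_finite_basis (F : fieldType) (E : fieldExtType F) (V : lmodType E)
    (H : vectType F) (f : {linear restrict_scalars E V -> H}) :
  bijective f ->
  exists (n : nat) (g : {linear 'rV[E]_n -> V}),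
    bijective g /\ (n * \dim {:E} = \dim {:H})%N.
Proof.
move=> f_bij; have f_inj := bij_inj f_bij; pose m := \dim {:E}.
pose e := vbasis {:E}.
(* Row [i] of [A] holds the coordinates over [F] of entry [i]; this turns ['rV[E]_n] into an
   [F]-space of dimension [n * m]. *)
pose toE n (A : 'M[F]_(n, m)) := \row_i \sum_j A i j *: e`_j : 'rV[E]_n.
have toE_lin n a : {morph @toE n : A B / a *: A + B >-> a%:A *: A + B}.
  move=> A B; apply/rowP => i; rewrite !mxE mulr_algl scaler_sumr -big_split.
  by apply: eq_bigr => j _; rewrite !mxE scalerDl scalerA.
have toE_bij n : bijective (@toE n).
  exists (fun x : 'rV[E]_n => \matrix_(i < n, j < m) coord e j (x 0 i)).
    move=> A; apply/matrixP => i j; rewrite !mxE coord_sum_free //.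
    exact: basis_free (vbasisP _).
  move=> x; apply/rowP => i; rewrite mxE [RHS](coord_vbasis (memvf _)).
  by apply: eq_bigr => j _; rewrite mxE.
have restrict n (g : {linear 'rV[E]_n -> V}) :
    exists h : {linear 'M[F]_(n, m) -> H}, h =1 f \o g \o @toE n.
  have h_lin : linear (f \o g \o @toE n).
    move=> a A B /=; rewrite toE_lin linearP /=.
    exact: (linearP f a (g (toE n A) : restrict_scalars E V)).
  pose h : {linear 'M[F]_(n, m) -> H} := HB.pack (f \o g \o @toE n)
    (GRing.isLinear.Build F 'M[F]_(n, m) H *:%R (f \o g \o @toE n) h_lin).
  by exists h.
have bound n (g : {linear 'rV[E]_n -> V}) : injective g -> (n * m <= \dim {:H})%N.
  move=> g_inj; have [h hE] := restrict n g.
  have : (\dim (limg (linfun h)) <= \dim {:H})%N by rewrite dimvS ?subvf.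
  rewrite limg_dim_eq ?dimvf ?dim_matrix // capfv; apply/eqP/lker0P => A B.
  by rewrite !lfunE /= !hE => /f_inj/g_inj/(bij_inj (toE_bij n)).
apply: NNPP => no_basis.
suff grow n : exists g : {linear 'rV[E]_n -> V}, injective g.
  have [g /bound] := grow (\dim {:H}).+1.
  by rewrite leqNgt (leq_trans _ (leq_pmulr _ (adim_gt0 {:E}%AS))).
elim: n => [|n [g g_inj]].
  by exists \0 => x y _; rewrite !thinmx0.
(* If [g] hit every vector, it would be the basis excluded by [no_basis]. *)
have [v gv] : exists v, forall x, g x != v.
  apply: NNPP => no_v; apply: no_basis; exists n, g.
  have g_surj v : exists x, g x == v.
    apply: NNPP => gv; apply: no_v; exists v => x; apply/negP => gx.
    by apply: gv; exists x.
  have g_bij : bijective g.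
    exists (fun v => xchoose (g_surj v)); last by move=> v; apply/eqP/(xchooseP (g_surj v)).
    by move=> x; apply: g_inj; apply/eqP/(xchooseP (g_surj (g x))).
  split=> //; have [h hE] := restrict n g.
  have h_bij : bijective h.
    exact: (eq_bij (bij_comp (bij_comp f_bij g_bij) (toE_bij n)) (fsym hE)).
  have h_inj : (fullv :&: lker (linfun h) = 0)%VS.
    rewrite capfv; apply/eqP/lker0P => A B; rewrite !lfunE /=; exact: bij_inj.
  rewrite -[LHS](dim_matrix F n m) -dimvf -(limg_dim_eq h_inj); congr (\dim _).
  apply/eqP; rewrite eqEsubv subvf; apply/subvP => y _.
  by have [h' _ h'K] := h_bij; rewrite -(h'K y) -[h _](lfunE h) memv_img ?memvf.
pose g' (x : 'rV[E]_(1 + n)) := lsubmx x 0 0 *: v + g (rsubmx x).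
have g'_lin : linear g'.
  move=> a x y; rewrite /g' !linearP !mxE /= scalerDl addrACA.
  by rewrite scalerA [_ * a]mulrC.
pose gL : {linear 'rV[E]_(1 + n) -> V} := HB.pack g'
  (GRing.isLinear.Build E 'rV[E]_(1 + n) V *:%R g' g'_lin).
exists gL => x y /= gxy.
have := g'_lin (-1) x y; rewrite gxy {gxy} !scaleN1r addNr.
set w : 'rV[E]_(1 + n) := _ + y; rewrite /g' => /eqP; rewrite addrC addr_eq0 => /eqP gw.
(* A nonzero first coordinate of [w] would express [v] through the image of [g]. *)
have [w0|w0] := eqVneq (lsubmx w 0 0) 0; last first.
  case/eqP: (gv (- (lsubmx w 0 0)^-1 *: rsubmx w)).
  by rewrite linearZ /= gw scalerN scaleNr opprK scalerA mulVf ?scale1r.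
have w_0 : w = 0.
  rewrite -[w]hsubmxK; have -> : lsubmx w = 0.
    by apply/rowP => i; rewrite [i]ord1 w0 mxE.
  by rewrite [rsubmx w](g_inj _ 0) ?row_mx0// gw w0 scale0r oppr0 linear0.
by move/eqP: w_0; rewrite /w addrC subr_eq0 => /eqP.
Qed.

(** * Choice of finitely many representatives *)

(** One element is chosen for each code that occurs. [I] is a relation because an object may have
    several codes, one for each choice of auxiliary data. *)
Lemma finite_representatives (X : finType) (T : Type) (P : T -> Prop)
    (I : T -> X -> Prop) (R : T -> T -> Prop) :
    (forall t, P t -> exists x, I t x) ->
    (forall t t' x, P t -> P t' -> I t x -> I t' x -> R t t') ->
  exists (n : nat) (G : 'I_n -> T),
    (forall i, P (G i)) /\ (forall t, P t -> exists i, R t (G i)).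
Proof.
move=> PI IR.
suff [n [G [PG GR]]] : exists n (G : 'I_n -> T), (forall i, P (G i)) /\
    (forall t x, P t -> x \in enum X -> I t x -> exists i, R t (G i)).
  exists n, G; split=> // t Pt; have [x Itx] := PI t Pt.
  by apply: GR Itx => //; rewrite mem_enum.
elim: (enum X) => [|x s [n [G [PG GR]]]].
  by exists 0%N, (fun i : 'I_0 => False_rect T (notF (ltn_ord i))); split=> [[]|].
have [[t0 [Pt0 It0]]|no_t] := classic (exists t, P t /\ I t x); last first.
  exists n, G; split=> // t y Pt; rewrite inE => /predU1P[->|ys] Ity.
    by case: no_t; exists t.
  exact: GR Ity.
exists n.+1, (fun i => oapp G t0 (unlift ord0 i)); split=> [i|t y Pt].
  by case: (unlift ord0 i) => [j|] /=; [exact: PG|].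
rewrite inE => /predU1P[->|ys] Ity.
  by exists ord0; rewrite unlift_none; apply: IR It0.
by have [i Ri] := GR t y Pt ys Ity; exists (lift ord0 i); rewrite liftK.
Qed.

(** * Lie brackets and the derived algebra *)

Section LieBracket.

Variables (K : fieldType) (L : lieAlgType K).
Implicit Types x y : L.

Lemma lie_bracketPl a x x' y :
  lie_bracket (a *: x + x') y = a *: lie_bracket x y + lie_bracket x' y.
Proof. exact: lie_bracket_linearl. Qed.

Lemma lie_bracketPr a x y y' :
  lie_bracket x (a *: y + y') = a *: lie_bracket x y + lie_bracket x y'.
Proof. exact: lie_bracket_linearr. Qed.

Lemma lie_bracketDl x x' y :
  lie_bracket (x + x') y = lie_bracket x y + lie_bracket x' y.
Proof. by have := lie_bracketPl 1 x x' y; rewrite !scale1r. Qed.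

Lemma lie_bracketDr x y y' :
  lie_bracket x (y + y') = lie_bracket x y + lie_bracket x y'.
Proof. by have := lie_bracketPr 1 x y y'; rewrite !scale1r. Qed.

Lemma lie_bracket0l y : lie_bracket 0 y = 0.
Proof. by apply: (addrI (lie_bracket 0 y)); rewrite -lie_bracketDl !addr0. Qed.

Lemma lie_bracket0r x : lie_bracket x 0 = 0.
Proof. by apply: (addrI (lie_bracket x 0)); rewrite -lie_bracketDr !addr0. Qed.

Lemma lie_bracketZl a x y : lie_bracket (a *: x) y = a *: lie_bracket x y.
Proof. by have := lie_bracketPl a x 0 y; rewrite lie_bracket0l !addr0. Qed.

Lemma lie_bracketBl x x' y :
  lie_bracket (x - x') y = lie_bracket x y - lie_bracket x' y.
Proof. by rewrite lie_bracketDl -[- x']scaleN1r lie_bracketZl scaleN1r. Qed.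

Lemma lie_bracketC x y : lie_bracket x y = - lie_bracket y x.
Proof.
apply/eqP; rewrite -addr_eq0; have := lie_bracketxx (x + y).
by rewrite lie_bracketDl !lie_bracketDr !lie_bracketxx add0r addr0 => ->.
Qed.

End LieBracket.

Section Derived.

Variables (K : fieldType) (L : finDimLieAlgType K).

Definition derived : {vspace L} :=
  <<[seq lie_bracket x y | x <- vbasis {:L}, y <- vbasis {:L}]>>%VS.

Lemma derived_ind (P : L -> Prop) :
    P 0 -> (forall a x y, P x -> P y -> P (a *: x + y)) ->
    (forall x y, P (lie_bracket x y)) ->
  forall x, x \in derived -> P x.
Proof.
move=> P0 Plin PL; apply: span_ind => // a x y /allpairsP[[u v] /= [_ _ ->]].
by apply: Plin.
Qed.

Lemma lie_bracket_derived x y : lie_bracket x y \in derived.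
Proof.
have span_vbasis z : z \in <<vbasis {:L}>>%VS by rewrite (span_basis (vbasisP _)) memvf.
move: x (span_vbasis x); apply: span_ind => [|a u x ub IHx].
  by rewrite lie_bracket0l mem0v.
rewrite lie_bracketPl rpredD ?rpredZ// {IHx x}.
move: y (span_vbasis y); apply: span_ind => [|b v y vb IHy].
  by rewrite lie_bracket0r mem0v.
by rewrite lie_bracketPr rpredD ?rpredZ// memv_span// allpairs_f.
Qed.

End Derived.

(** * Actions through the centroid *)

Section Centroid.

Variables (F : fieldType) (E : fieldExtType F) (h : finDimLieAlgType F).

Definition centroid_action (R : {linear E -> 'End(h)}) : Prop :=
  (forall a b x, R (a * b) x = R a (R b x)) /\
  (forall a x y, lie_bracket (R a x) y = R a (lie_bracket x y)).

Lemma centroid_actionr R a x y :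
  centroid_action R -> lie_bracket x (R a y) = R a (lie_bracket x y).
Proof. by case=> _ RL; rewrite lie_bracketC RL -linearN -lie_bracketC. Qed.

Lemma centroid_action_derived R a x :
  centroid_action R -> x \in derived h -> R a x \in derived h.
Proof.
move=> [_ RL]; move: x; apply: derived_ind => [|c x y Rx Ry|x y].
- by rewrite linear0 mem0v.
- by rewrite linearP rpredD ?rpredZ.
- by rewrite -RL lie_bracket_derived.
Qed.

(** On a bracket, [R a] can be moved into the first argument and [R' b] into the second, in either
    order. *)
Lemma centroid_action_comm R R' a b x :
    centroid_action R -> centroid_action R' -> x \in derived h ->
  R a (R' b x) = R' b (R a x).
Proof.
move=> RC R'C; move: x; apply: derived_ind => [|c x y Rx Ry|x y].
- by rewrite !linear0.
- by rewrite !linearP /= Rx Ry.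
- by rewrite -(centroid_actionr _ _ _ R'C) -RC.2 -RC.2 (centroid_actionr _ _ _ R'C).
Qed.

(** Composing with the projection onto the derived algebra gives endomorphisms of all of [h]. They
    are still multiplicative in [E], since [R a] preserves the derived algebra, and actions for
    different [R] commute. *)
Lemma finite_restricted_centroid_actions (galEF : galois_extension E) (b : seq E) :
  exists s : seq 'End(h), forall R x, centroid_action R -> x \in b ->
    (R x \o projv (derived h))%VF \in s.
Proof.
pose e := vbasis {:h}; pose p := projv (derived h).
pose matrix_of (R : {linear E -> 'End(h)}) (M : {linear E -> 'M[F]_(\dim {:h})}) :=
  forall a, M a = passmx.mxof e e (R a \o p)%VF.
have pE x : x \in derived h -> p x = x by exact: projv_id.
have pD x : p x \in derived h by exact: memv_proj.
have e_basis := vbasisP {:h}.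
have [||s sP] := @finite_commuting_representations F E galEF _
  (fun M => exists2 R, centroid_action R & matrix_of R M) b.
- move=> M [R RC MR] x y; rewrite !MR -passmx.mxof_comp//; congr passmx.mxof.
  apply/lfunP => v; rewrite !comp_lfunE /= [p (R x _)]pE ?centroid_action_derived//.
  (* Matrices act on row vectors, which reverses composition; commutativity of [E] restores the
     order. *)
  by rewrite mulrC RC.1.
- move=> M M' x y [R RC MR] [R' RC' MR'].
  rewrite MR MR' -!passmx.mxof_comp//; congr passmx.mxof.
  apply/lfunP => v; rewrite !comp_lfunE /= ![p (fun_of_lfun _ (p v))]pE ?centroid_action_derived//.
  exact: centroid_action_comm.
exists (map (passmx.hommx e e) s) => R x RC xb; apply/mapP.
pose Mfun a := passmx.mxof e e (R a \o p)%VF.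
have M_lin : linear Mfun.
  by move=> a u v; rewrite /Mfun linearP comp_lfunDl -comp_lfunZl passmx.mxof_linear.
pose M : {linear E -> 'M[F]_(\dim {:h})} := HB.pack Mfun
  (GRing.isLinear.Build F E 'M[F]_(\dim {:h}) *:%R Mfun M_lin).
exists (M x); last by rewrite [RHS]passmx.mxofK.
by apply: sP => //; exists R.
Qed.

End Centroid.

(** * Comparing Lie algebras through their actions *)

(** Scalar multiplication transported along [f]; it lands in the centroid because the bracket of [g]
    is [E]-bilinear. *)
Lemma centroid_action_of_isomorphism (F : fieldType) (E : fieldExtType F)
    (h : finDimLieAlgType F) (g : lieAlgType E)
    (f : {linear restrict_scalars E g -> h}) :
    bijective f -> {morph f : x y / lie_bracket x y >-> lie_bracket x y} ->
  exists2 R : {linear E -> 'End(h)}, centroid_action R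
    & forall a x, R a (f x) = f (a *: (x : g)).
Proof.
move=> [f' fK f'K] fL; pose act a v := f (a *: (f' v : g)).
have actE a x : act a (f x) = f (a *: (x : g)) by rewrite /act fK.
have act_lin a : linear (act a).
  move=> c u v; rewrite -[u]f'K -[v]f'K -linearP !actE -linearP; congr (f _).
  rewrite [LHS](scalerDr a (c%:A *: (f' u : g)) (f' v : g)); congr (_ + _).
  by rewrite restr_scaleE !scalerA mulrC.
pose actL a : {linear h -> h} := HB.pack (act a)
  (GRing.isLinear.Build F h h *:%R (act a) (act_lin a)).
pose R a := linfun (actL a) : 'End(h).
have RE a x : R a (f x) = f (a *: (x : g)) by rewrite lfunE /= actE.
have R_lin : linear R.
  move=> c a b; apply/lfunP => v; rewrite -[v]f'K add_lfunE scale_lfunE !RE -linearP.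
  by congr (f _); rewrite restr_scaleE scalerDl scalerA mulr_algl.
pose RL : {linear E -> 'End(h)} := HB.pack R
  (GRing.isLinear.Build F E 'End(h) *:%R R R_lin).
exists RL; last exact: RE.
split=> [a b v|a u v] /=; first by rewrite -[v]f'K !RE -scalerA.
by rewrite -[u]f'K -[v]f'K RE -!fL RE; congr (f _); exact: (lie_bracketZl a (f' u : g) (f' v : g)).
Qed.

Lemma isomorphic_of_eq_on_derived (F : fieldType) (E : fieldExtType F)
    (h : finDimLieAlgType F) (g1 g2 : lieAlgType E)
    (f1 : {linear restrict_scalars E g1 -> h})
    (f2 : {linear restrict_scalars E g2 -> h})
    (R1 R2 : {linear E -> 'End(h)}) :
    bijective f1 -> {morph f1 : x y / lie_bracket x y >-> lie_bracket x y} ->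
    bijective f2 -> {morph f2 : x y / lie_bracket x y >-> lie_bracket x y} ->
    (forall a x, R1 a (f1 x) = f1 (a *: (x : g1))) ->
    (forall a x, R2 a (f2 x) = f2 (a *: (x : g2))) ->
    {in derived h, forall x a, R1 a x = R2 a x} ->
  lie_isomorphic g1 g2.
Proof.
move=> f1_bij f1L f2_bij f2L R1f R2f eqR.
have [n1 [b1 [b1_bij dim1]]] := exists_finite_basis f1_bij.
have [n2 [b2 [b2_bij dim2]]] := exists_finite_basis f2_bij.
have vector_axiom n (g : lieAlgType E) (b : {linear 'rV[E]_n -> g}) :
    bijective b -> inhabited (Vector.axiom n g).
  move=> [b' bK b'K]; split; exists b'; last by exists b.
  by move=> a x y; apply: (can_inj bK); rewrite linearP !b'K.
have [ax1] := vector_axiom _ _ _ b1_bij; have [ax2] := vector_axiom _ _ _ b2_bij.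
(* [g1] and [g2] are equipped with finite-dimensional structures on their own carriers. *)
pose V1 : finDimLieAlgType E := HB.pack (LieAlgebra.sort g1) (Lmodule_hasFinDim.Build E g1 ax1).
pose V2 : finDimLieAlgType E := HB.pack (LieAlgebra.sort g2) (Lmodule_hasFinDim.Build E g2 ax2).
have eq_dim : \dim {:V1} = \dim {:V2}.
  have /eqP : (n1 * \dim {:E} = n2 * \dim {:E})%N by rewrite dim1.
  by rewrite eqn_pmul2r ?adim_gt0 // !dimvf => /eqP.
have [f2' f2K f2'K] := f2_bij.
pose theta (x : V1) : V2 := f2' (f1 x).
have f2_theta x : f2 (theta x) = f1 x by exact: f2'K.
have f2_inj := can_inj f2K.
have theta_bij : bijective theta by apply: bij_comp => //; exists f2.
have thetaD : {morph theta : x y / x + y}.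
  move=> x y; apply: f2_inj; rewrite f2_theta.
  by rewrite [LHS](linearD f1) [RHS](linearD f2) !f2_theta.
have thetaL x y : theta (lie_bracket x y) = lie_bracket (theta x) (theta y).
  apply: f2_inj; rewrite f2_theta.
  by rewrite [LHS]f1L [RHS]f2L !f2_theta.
have theta_lin : {in derived V1, forall x a, theta (a *: x) = a *: theta x}.
  have theta0 : theta 0 = 0 by apply: (addrI (theta 0)); rewrite -thetaD !addr0.
  apply: derived_ind => [a|c x y IHx IHy a|x y a].
  - by rewrite scaler0 theta0 scaler0.
  - by rewrite scalerDr !thetaD scalerA IHx IHy IHx scalerDr scalerA.
  apply: f2_inj; rewrite f2_theta -R1f -[RHS]R2f f2_theta; apply: eqR.
  by rewrite f1L lie_bracket_derived.
pose central (z : V2) := forall y, lie_bracket z y = 0.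
have [y|a x y Zx Zy z|a x y|tau [tau_bij tauD tauZ]] :=
  linear_correction (Z := central) eq_dim theta_bij thetaD theta_lin.
- exact: lie_bracket0l.
- by rewrite lie_bracketPl Zx Zy scaler0 addr0.
(* The defect of [E]-linearity is central: its bracket with [theta y] is
   [theta (a *: u) - a *: theta u] for a bracket [u], and [theta] is [E]-linear on brackets. *)
- have [theta' _ theta'K] := theta_bij; rewrite -(theta'K y).
  rewrite lie_bracketBl lie_bracketZl -!thetaL lie_bracketZl.
  by rewrite theta_lin ?subrr// lie_bracket_derived.
exists tau; split=> // x y.
have tauE z w : lie_bracket (tau z) w = lie_bracket (theta z) w.
  by apply/eqP; rewrite -subr_eq0 -lie_bracketBl tauZ.
rewrite [LHS]tauD ?lie_bracket_derived// thetaL.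
by rewrite [RHS]tauE lie_bracketC [RHS]lie_bracketC tauE.
Qed.

(** * Finiteness of the isomorphism classes *)

Theorem corollary4p4 (F : fieldType) (E : fieldExtType F)
    (galEF : galois_extension E) (h : finDimLieAlgType F) :
  exists (n : nat) (G : 'I_n -> lieAlgType E),
    (forall i : 'I_n, lie_isomorphic (restrict_scalars E (G i)) h) /\
    (forall g : lieAlgType E,
       lie_isomorphic (restrict_scalars E g) h ->
       exists i : 'I_n, lie_isomorphic g (G i)).
Proof.
pose m := \dim {:E}; pose e := vbasis {:E}.
have [s sP] := finite_restricted_centroid_actions h galEF e.
(* A code lists, for each basis vector of [E], the position in [s] of its action on the derived
   algebra. *)
pose coded (g : lieAlgType E) (c : {ffun 'I_m -> 'I_(size s)}) :=
  exists (f : {linear restrict_scalars E g -> h}) (R : {linear E -> 'End(h)}),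
    [/\ bijective f, {morph f : x y / lie_bracket x y >-> lie_bracket x y},
        forall a x, R a (f x) = f (a *: (x : g))
      & forall j : 'I_m, (R e`_j \o projv (derived h))%VF = s`_(c j)].
apply: (@finite_representatives _ _ _ coded) => [g [f [f_bij fL]]|g1 g2 c _ _].
  have [R RC Rf] := centroid_action_of_isomorphism f_bij fL.
  pose phi (j : 'I_m) := (R e`_j \o projv (derived h))%VF.
  have phi_s j : phi j \in s by apply: sP => //; rewrite mem_nth ?size_tuple.
  have phi_lt j : (index (phi j) s < size s)%N by rewrite index_mem.
  exists [ffun j => Ordinal (phi_lt j)], f, R; split=> // j.
  by rewrite ffunE /= nth_index.
move=> [f1 [R1 [f1_bij f1L R1f R1c]]] [f2 [R2 [f2_bij f2L R2f R2c]]].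
apply: (isomorphic_of_eq_on_derived f1_bij f1L f2_bij f2L R1f R2f) => x xD a.
(* By [F]-linearity the actions need comparing only on the basis [e], where equal codes make them
   agree. *)
rewrite (coord_vbasis (memvf a)) !linear_sum !sum_lfunE; apply: eq_bigr => j _.
have := congr1 (fun u : 'End(h) => u x) (etrans (R1c j) (esym (R2c j))).
by rewrite !comp_lfunE projv_id // !linearZ !scale_lfunE => ->.
Qed.
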